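(* Let $\mathcal P$ be an infinite set of prime numbers, and let $\varepsilon$ and $\kappa$ be positive real numbers with $\kappa<1$. Let $\{a_n\}_{n=1}^\infty$ and $\{b_n\}_{n=1}^\infty$ be sequences of non-zero integers such that for each $p\in\mathcal P$: $p\nmid\gcd(a_n,b_n)$ for all $n$, and the sequence $\{\nu_p(a_n)\}_n$ is bounded and attains its maximum value for exactly one $n$. Suppose that $a_{n+1}\ge a_n\ge n^{1+\varepsilon}$ and $|b_n|\le 2^{(\log_2|a_n|)^\kappa}$ for all $n$. Then the sequence $\{a_n/b_n\}$ is $\mathcal P$-irrational if $\limsup_{n\to\infty}|a_n|^{1/2^n}=\infty$, and it is $\mathcal P$-transcendental if $\limsup_{n\to\infty}a_n^{1/A^n}=\infty$ for every positive integer $A$.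
   Context: $\nu_p$ denotes the $p$-adic valuation. For a set $\mathcal P$ of primes, a sequence $\{x_n\}_{n=1}^\infty$ of non-zero numbers is $\mathcal P$-irrational (resp. $\mathcal P$-transcendental) if for every sequence of integers $\{c_n\}_{n=1}^\infty$ with $p\nmid c_n$ for all $p\in\mathcal P$ and all $n$, the series $\sum_{n=1}^\infty\frac{1}{x_nc_n}$ converges to an irrational (resp. transcendental) number. *)

(* Defs.v *)
(* sequences are indexed from 1 (value at 0 ignored). *)
From HB Require Import structures.
From mathcomp Require Import all_boot all_order all_algebra.
From mathcomp Require Import all_classical all_reals all_analysis.
Set Implicit Arguments. Unset Strict Implicit. Unset Printing Implicit Defensive.
Import Order.TTheory GRing.Theory Num.Theory.
Import numFieldNormedType.Exports.
Local Open Scope classical_set_scope.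
Local Open Scope ring_scope.

Definition irrational (R : realType) (x : R) : Prop := ~ exists q : rat, x = ratr q.

Definition transcendental (R : realType) (x : R) : Prop :=
  ~ exists p : {poly int}, p != 0 /\ root (map_poly intr p) x.

Definition series_from1_to (R : realType) (u : nat -> R) (l : R) : Prop :=
  (fun N : nat => \sum_(1 <= k < N) u k) @ \oo --> l.

Definition P_irrational (R : realType) (P : set nat) (x : nat -> R) : Prop :=
  forall c : nat -> int,
    (forall n p, (1 <= n)%N -> P p -> ~~ (p %| `|c n|)%N) ->
    exists l : R, series_from1_to (fun n => 1 / (x n * (c n)%:~R)) l /\ irrational l.

Definition P_transcendental (R : realType) (P : set nat) (x : nat -> R) : Prop :=
  forall c : nat -> int,
    (forall n p, (1 <= n)%N -> P p -> ~~ (p %| `|c n|)%N) ->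
    exists l : R, series_from1_to (fun n => 1 / (x n * (c n)%:~R)) l /\ transcendental l.

Definition log2 (R : realType) (x : R) : R := ln x / ln 2.

(* Main.v *)
Require Import Defs.
From HB Require Import structures.
From mathcomp Require Import all_boot all_order all_algebra.
From mathcomp Require Import all_classical all_reals all_analysis.
From mathcomp Require Import ring lra zify.
Set Implicit Arguments. Unset Strict Implicit. Unset Printing Implicit Defensive.
Import Order.TTheory GRing.Theory Num.Theory.
Import numFieldNormedType.Exports.
Local Open Scope classical_set_scope.
Local Open Scope ring_scope.

(** Write x for the sum of the series and x_j = a_j |c_j|.  For p in P, the term
    where nu_p (a_n) is maximal is the only one with the worst pole at p, so p divides
    the denominator of every finite sub-sum that contains it.  By the rational root
    argument, such a sub-sum S is not a root of an integer polynomial f whose leading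
    coefficient is prime to p; since P is infinite, some p is prime to the leading
    coefficient of a given f.  If f has degree d and f(x) = 0, then
    f(S) = O(|x - S|), while f(S) D^d is a non-zero integer, where D is the product of
    the x_j over the sub-sum: it remains to find S with D^d |x - S| small.

    As the c_j are arbitrary, the terms are first reordered by increasing x_j; the
    sorted sequence y_n still satisfies y_n >= a_n.  Put l_n = ln y_n, s_N the sum of
    the first N of them and A = d + 1, so that D^d = exp (d s_N).  The tail from N on is
    at most C exp (- delta l_N) in general, and about exp (2 l_N^kappa - l_N) as long as
    l_n grows at least linearly.  If neither bound ever beats exp (- d s_N), then
    s_(N+1) / A^(N+1) <= s_N / A^N up to a summable relative error, on all stretches
    that matter, which bounds l_n / A^n and contradicts the hypothesis on the limsup. *)

(** * Elementary inequalities for real powers and logarithms *)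

Lemma powR_inv_telescope (R : realType) (e : R) (n : nat) : 0 < e ->
  n.+2%:R `^ (- (1 + e)) <= e^-1 * (n.+1%:R `^ (- e) - n.+2%:R `^ (- e)).
Proof.
move=> e0; rewrite -(ler_pM2l e0) mulVKf ?gt_eqF// lerBrDr.
have n20 : 0 < n.+2%:R :> R by rewrite ltr0n.
have n10 : 0 < n.+1%:R :> R by rewrite ltr0n.
(* Bernoulli's inequality, from ln (1 + x) <= x and 1 + x <= exp x. *)
have step : 1 + e / n.+2%:R <= (n.+1%:R / n.+2%:R) `^ (- e).
  rewrite /powR gt_eqF ?divr_gt0//.
  apply: le_trans (expR_ge1Dx _).
  rewrite lerD2l mulNr -mulrN ler_wpM2l ?(ltW e0)//.
  have -> : n.+1%:R / n.+2%:R = 1 + - n.+2%:R^-1 :> R.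
    apply: (mulIf (lt0r_neq0 n20)); rewrite mulrDl mulNr !mulfVK ?gt_eqF//.
    by rewrite mulVf ?gt_eqF// -[n.+2]addn1 natrD; ring.
  rewrite lerNr; apply: le_ln1Dx.
  by rewrite ltrN2 invf_lt1// ltr1n.
have -> : n.+1%:R `^ (- e) = (n.+1%:R / n.+2%:R) `^ (- e) * n.+2%:R `^ (- e) :> R.
  by rewrite -powRM ?divr_ge0 ?mulfVK ?gt_eqF.
have -> : n.+2%:R `^ (- (1 + e)) = n.+2%:R^-1 * n.+2%:R `^ (- e) :> R.
  rewrite opprD powRD; last by apply/implyP => _; rewrite gt_eqF.
  by rewrite powR_inv1 ?ltW.
rewrite mulrA -[X in _ + X <= _]mul1r -mulrDl ler_wpM2r ?powR_ge0//.
by rewrite addrC.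
Qed.

Lemma sum_powR_le (R : realType) (e : R) (m N : nat) : 0 < e ->
  \sum_(m <= n < N) n.+1%:R `^ (- (1 + e)) <= 1 + e^-1.
Proof.
move=> e0.
have le0 M : \sum_(0 <= n < M.+1) n.+1%:R `^ (- (1 + e))
    <= 1 + e^-1 * (1 - M.+1%:R `^ (- e)).
  elim: M => [|M IH]; first by rewrite big_nat1 !powR1 subrr mulr0 addr0.
  rewrite big_nat_recr//=.
  apply: le_trans (lerD IH (powR_inv_telescope M e0)) _.
  by rewrite -addrA -mulrDr addrA subrK.
have [mN|Nm] := ltnP m N; last by rewrite big_geq// addr_ge0// invr_ge0 ltW.
apply: (@le_trans _ _ (\sum_(0 <= n < N.-1.+1) n.+1%:R `^ (- (1 + e)))).
  rewrite prednK ?(leq_trans _ mN)// [leRHS](big_cat_nat (n := m))//= ?(ltnW mN)//.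
  by rewrite lerDr sumr_ge0// => i _; rewrite powR_ge0.
apply: le_trans (le0 _) _; rewrite lerD2l ler_piMr ?gerBl ?powR_ge0 ?invr_ge0 ?(ltW e0)//.
Qed.

(** The constant is read off at [X], where x^(kappa - 1) equals [delta]: beyond it the power lies
    below the line [delta * x], before it the power is at most its value at [X]. *)
Lemma powR_le_linear (R : realType) (kappa delta : R) :
  0 < kappa -> kappa < 1 -> 0 < delta ->
  exists2 C : R, 0 <= C & forall x, 0 <= x -> x `^ kappa <= delta * x + C.
Proof.
move=> k0 k1 d0; pose X := delta `^ (- (1 - kappa)^-1).
have X0 : 0 < X by rewrite powR_gt0.
exists (X `^ kappa) => [|x x0]; first exact: powR_ge0.
have [xX|Xx] := leP x X.
  apply: (@le_trans _ _ (X `^ kappa)); last by rewrite lerDr mulr_ge0// ltW.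
  by rewrite ge0_ler_powR ?nnegrE ?powR_ge0 ?(ltW k0) ?x0 ?(ltW X0).
apply: (@le_trans _ _ (delta * x)); last by rewrite lerDl powR_ge0.
have xp : 0 < x by apply: lt_trans Xx.
rewrite -(mulr_powRB1 x0 k0) mulrC ler_wpM2r//.
have -> : delta = (X `^ (1 - kappa))^-1.
  rewrite /X -powRrM mulNr mulVf ?subr_eq0 ?gt_eqF//.
  by rewrite powR_inv1 ?invrK ?(ltW d0).
rewrite -opprB powRN lef_pV2 ?posrE ?powR_gt0//.
by rewrite ge0_ler_powR ?nnegrE ?subr_ge0 ?ltW.
Qed.

(** Writing x^kappa as x times x^(kappa - 1), the difference of the powers is at most (y - x)
    x^(kappa - 1), and the hypothesis on [x] makes the last factor at most 1/2. *)
Lemma powR_increment_le (R : realType) (kappa x y : R) :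
  0 < kappa -> kappa < 1 -> 0 < x -> 2 <= x `^ (1 - kappa) -> x <= y ->
  2 * (y `^ kappa - x `^ kappa) <= y - x.
Proof.
move=> k0 k1 x0 x2 xy.
have y0 : 0 < y by apply: lt_le_trans xy.
have hx : x `^ (kappa - 1) <= 2^-1.
  by rewrite -opprB powRN lef_pV2 ?posrE ?powR_gt0.
have hyx : y `^ (kappa - 1) <= x `^ (kappa - 1).
  rewrite -opprB !powRN lef_pV2 ?posrE ?powR_gt0//.
  by rewrite ge0_ler_powR ?nnegrE ?subr_ge0 ?(ltW k1) ?(ltW x0) ?(ltW y0).
rewrite -(mulr_powRB1 (ltW y0) k0) -(mulr_powRB1 (ltW x0) k0).
have : y * y `^ (kappa - 1) <= y * x `^ (kappa - 1) by rewrite ler_wpM2l// ltW.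
have : (y - x) * x `^ (kappa - 1) <= (y - x) * 2^-1 by rewrite ler_wpM2l// subr_ge0.
lra.
Qed.

Lemma ln_le_powR (R : realType) (s x : R) : 0 < s -> 0 < x ->
  ln x <= x `^ s / s.
Proof.
move=> s0 x0; rewrite ler_pdivlMr// mulrC -ln_powR.
by apply/ltW/ln_sublinear; rewrite powR_gt0.
Qed.

(** The kappa-th power of the constant is 2 / kappa, which cancels the 1 / kappa of [ln_le_powR]. *)
Lemma ln_le_powR_of_linear (R : realType) (kappa x : R) (n : nat) :
  0 < kappa -> (2 / kappa) `^ kappa^-1 * n.+1%:R <= x ->
  2 * ln n.+1%:R <= x `^ kappa.
Proof.
move=> k0 hx.
have q0 : 0 <= (2 / kappa) `^ kappa^-1 * n.+1%:R by rewrite mulr_ge0 ?powR_ge0.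
apply: (@le_trans _ _ (((2 / kappa) `^ kappa^-1 * n.+1%:R) `^ kappa)); last first.
  by rewrite ge0_ler_powR ?nnegrE ?(ltW k0)// (le_trans q0).
rewrite powRM ?powR_ge0// -powRrM mulVf ?gt_eqF// powRr1 ?divr_ge0 ?(ltW k0)//.
by rewrite -mulrA ler_pM2l// mulrC ln_le_powR.
Qed.

(** * Tail bounds for the sum of exp (l_n^kappa - l_n) *)

Lemma crude_tail_bound (R : realType) (eps kappa : R) :
  0 < eps -> 0 < kappa -> kappa < 1 ->
  exists C delta : R, [/\ 0 < C, 0 < delta & forall l : nat -> R,
    {homo l : m n / (m <= n)%N >-> m <= n} ->
    (forall n, (1 + eps) * ln n.+1%:R <= l n) ->
    forall M N, \sum_(M <= n < N) expR (l n `^ kappa - l n)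
      <= C * expR (- (delta * l M))].
Proof.
(* With this [delta], (1 - 2 delta)(1 + eps) = 1 + eps / 2: of the exponent l_n, one share delta
   absorbs l_n^kappa, another becomes the decay in [l M], and the rest still makes the series over n
   converge. *)
move=> e0 k0 k1; pose delta := eps / (4 * (1 + eps)).
have e1 : 0 < 1 + eps by rewrite addr_gt0.
have d0 : 0 < delta by rewrite divr_gt0// mulr_gt0.
have [C1 C10 hC1] := powR_le_linear k0 k1 d0.
have e20 : 0 < eps / 2 by rewrite divr_gt0.
have dE : (1 - 2 * delta) * (1 + eps) = 1 + eps / 2.
  by rewrite /delta; field; rewrite gt_eqF.
have d12 : 0 < 1 - 2 * delta.
  by rewrite -(pmulr_lgt0 _ e1) dE addr_gt0.
exists (expR C1 * (1 + (eps / 2)^-1)), delta; split => //.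
  by rewrite mulr_gt0 ?expR_gt0// addr_gt0 ?invr_gt0.
move=> l lmono lge M N.
apply: (@le_trans _ _ (\sum_(M <= n < N) (expR C1 * expR (- (delta * l M)))
   * n.+1%:R `^ (- (1 + eps / 2)))); last first.
  by rewrite -mulr_sumr [leRHS]mulrAC ler_wpM2l ?mulr_ge0 ?expR_ge0 ?sum_powR_le.
rewrite big_nat_cond [leRHS]big_nat_cond.
apply: ler_sum => n; rewrite andbT => /andP[Mn _].
rewrite [X in _ <= _ * X]/powR gt_eqF ?ltr0n// -!expRD ler_expR.
have ln0 : 0 <= ln n.+1%:R :> R by rewrite ln_ge0 ?ler1n.
have l0 : 0 <= l n by apply: le_trans (lge n); rewrite mulr_ge0// ltW.
have := hC1 _ l0.
have : delta * l M <= delta * l n by rewrite ler_pM2l// lmono.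
have : (1 - 2 * delta) * ((1 + eps) * ln n.+1%:R) <= (1 - 2 * delta) * l n.
  by rewrite ler_pM2l.
rewrite mulrA dE; lra.
Qed.

(** By [powR_increment_le], 2 l_n^kappa - l_n is at most its value at N, and linear growth makes the
    remaining factor exp (- l_n^kappa) at most (n + 1)^-2; these sum to at most 2. *)
Lemma fine_tail_bound (R : realType) (kappa : R) (l : nat -> R) (N M : nat) :
  0 < kappa -> kappa < 1 -> {homo l : m n / (m <= n)%N >-> m <= n} ->
  0 < l N -> 2 <= l N `^ (1 - kappa) ->
  (forall n, (N <= n < M)%N -> (2 / kappa) `^ kappa^-1 * n.+1%:R <= l n) ->
  \sum_(N <= n < M) expR (l n `^ kappa - l n)
    <= 2 * expR (- (l N - 2 * l N `^ kappa)).
Proof.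
move=> k0 k1 lmono lN0 lN2 hl.
apply: (@le_trans _ _ (\sum_(N <= n < M) expR (- (l N - 2 * l N `^ kappa))
   * n.+1%:R `^ (- (1 + 1)))); last first.
  rewrite -mulr_sumr mulrC ler_wpM2r ?expR_ge0//.
  by apply: le_trans (sum_powR_le _ _ _) _; rewrite ?invr1.
rewrite big_nat_cond [leRHS]big_nat_cond.
apply: ler_sum => n; rewrite andbT => nNM.
rewrite [X in _ <= _ * X]/powR gt_eqF ?ltr0n// -!expRD ler_expR.
have := ln_le_powR_of_linear k0 (hl _ nNM).
have lNn : l N <= l n by apply: lmono; case/andP: nNM.
have := powR_increment_le k0 k1 lN0 lN2 lNn.
lra.
Qed.

(** * Growth of the partial sums and choice of a small tail *)

Lemma fine_step (R : realType) (kappa A K S l : R) (n : nat) :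
  0 < kappa -> kappa < 1 -> 1 <= A -> 0 <= K -> 0 <= S -> 0 <= l ->
  S + l <= A * S + K + 2 * l `^ kappa ->
  (1 + (S + l) / A ^+ n.+1) * (1 - (K + 2) * (A `^ (kappa - 1)) ^+ n.+1)
    <= 1 + S / A ^+ n.
Proof.
move=> k0 k1 A1 K0 S0 l0 hS; have A0 : 0 < A by lra.
set q := A `^ (kappa - 1).
pose P := A ^+ n.+1; have P0 : 0 < P by rewrite exprn_gt0.
have P1 : 1 <= P by rewrite exprn_ege1.
set u := (S + l) / P.
have u0 : 0 <= u by rewrite divr_ge0 ?addr_ge0// ltW.
have qE : q ^+ n.+1 = P `^ kappa / P.
  rewrite /P -(powR_mulrn _ (ltW A0)) -!powRrM -(powR_mulrn n.+1 (powR_ge0 _ _)).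
  rewrite /q -powRrM -powRB; last by rewrite (gt_eqF A0) implybT.
  by congr (_ `^ _); ring.
have q1 : P^-1 <= q ^+ n.+1.
  rewrite qE ler_peMl ?invr_ge0 ?(ltW P0)//.
  by rewrite -(powRr0 P) ler_powR// ltW.
have uk : u `^ kappa <= 1 + u.
  have [u1|u1] := leP u 1.
    apply: (@le_trans _ _ 1); last by rewrite lerDl.
    have -> : 1 = 1 `^ kappa :> R by rewrite powR1.
    by rewrite ge0_ler_powR ?nnegrE ?(ltW k0).
  by apply: le_trans (ler1_powR (ltW u1) (ltW k1)) _; rewrite lerDr.
(* As l <= u P, the sublinear error is at most u^kappa P^(kappa - 1), hence small relative to 1 + u.
   This is why 1 is added to the normalised sums in the statement. *)
have lk : l `^ kappa / P <= (1 + u) * q ^+ n.+1.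
  apply: (@le_trans _ _ (u `^ kappa * q ^+ n.+1)); last first.
    by rewrite ler_wpM2r// exprn_ge0// powR_ge0.
  rewrite qE mulrA -powRM ?(ltW P0)// /u mulfVK ?gt_eqF//.
  rewrite ler_wpM2r ?invr_ge0 ?(ltW P0)//.
  by rewrite ge0_ler_powR ?nnegrE ?(ltW k0)// ?addr_ge0// lerDr.
have uE : u <= S / A ^+ n + K * P^-1 + 2 * (l `^ kappa / P).
  rewrite /u ler_pdivrMr//; apply: le_trans hS _; rewrite le_eqVlt; apply/orP; left.
  apply/eqP; rewrite /P exprS; field.
  by rewrite !gt_eqF ?exprn_gt0.
have : K * P^-1 <= K * ((1 + u) * q ^+ n.+1).
  rewrite ler_wpM2l//; apply: le_trans q1 _.
  by rewrite ler_peMl ?lerDl// exprn_ge0// powR_ge0.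
lra.
Qed.

(** The weight telescopes: its exponents at n and n + 1 differ by 2 K q^(n+1), which pays for the
    loss 1 / (1 - x) <= exp (2 x), valid for 0 <= x <= 1/2. *)
Lemma decay_step (R : realType) (K q v w : R) (n : nat) :
  0 <= K -> 0 <= q -> q < 1 -> 0 <= v -> K * q ^+ n.+1 <= 2^-1 ->
  w * (1 - K * q ^+ n.+1) <= v ->
  w * expR (2 * K * q / (1 - q) * q ^+ n.+1) <= v * expR (2 * K * q / (1 - q) * q ^+ n).
Proof.
move=> K0 q0 q1 v0 Kq hw; set c := 2 * K * q / (1 - q).
have cE : c * q ^+ n = 2 * (K * q ^+ n.+1) + c * q ^+ n.+1.
  by rewrite /c exprS; field; rewrite subr_eq0 gt_eqF.
rewrite cE expRD mulrA ler_wpM2r ?expR_ge0//.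
set x := K * _ in Kq hw *.
have x0 : 0 <= x by rewrite mulr_ge0 ?exprn_ge0.
have x1 : 0 < 1 - x by lra.
have : w <= v / (1 - x) by rewrite ler_pdivlMr.
move=> /le_trans; apply; rewrite ler_wpM2l//.
apply: le_trans (expR_ge1Dx _).
rewrite -[leLHS]mul1r ler_pdivrMr//; nra.
Qed.

Lemma sqr_le_4exp2 (n : nat) : (n ^ 2 <= 4 * 2 ^ n)%N.
Proof.
have ge4 m : (m.+4 ^ 2 <= 2 ^ m.+4)%N.
  elim: m => // m IH; rewrite [X in (_ <= X)%N]expnS; apply: leq_trans (leq_mul (leqnn 2) IH).
  nia.
case: n => [|[|[|[|n]]]] //.
by apply: leq_trans (ge4 n) _; rewrite leq_pmull.
Qed.

(* [k] comes right after the last failure of linear growth before [M], where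
   monotonicity makes the partial sum at most quadratic. *)
Lemma last_slow_index (R : realType) (A lam : R) (l : nat -> R) (N1 M : nat) :
  2 <= A -> 0 <= lam -> {homo l : m n / (m <= n)%N >-> m <= n} ->
  (forall n, 0 <= l n) -> (N1 <= M)%N ->
  exists k, [/\ (N1 <= k <= M)%N,
    forall n, (k <= n < M)%N -> lam * n.+1%:R <= l n &
    (\sum_(0 <= n < k) l n) / A ^+ k <= \sum_(0 <= n < N1) l n + 4 * lam].
Proof.
move=> A2 lam0 lmono l0; have A0 : 0 < A by lra.
have S0 n : 0 <= \sum_(0 <= i < n) l i by apply: sumr_ge0.
elim: M => [|M IH] N1M.
  exists N1; rewrite leqnn N1M; split => //.
    by move=> n; rewrite ltn0 andbF.
  move: N1M; rewrite leqn0 => /eqP ->.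
  by rewrite expr0 divr1 lerDl mulr_ge0.
have hN1 : (\sum_(0 <= n < N1) l n) / A ^+ N1 <= \sum_(0 <= n < N1) l n + 4 * lam.
  apply: (@le_trans _ _ (\sum_(0 <= n < N1) l n)); last by rewrite lerDl mulr_ge0.
  by rewrite ler_pdivrMr ?exprn_gt0// ler_peMr// exprn_ege1//; lra.
move: N1M; rewrite leq_eqVlt => /orP[/eqP <-|].
  exists N1; rewrite leqnn; split => // n /andP[a b].
  by move: (leq_ltn_trans a b); rewrite ltnn.
rewrite ltnS => /IH [k [/andP[N1k kM] hk Sk]].
have [hM|hM] := leP (lam * M.+1%:R) (l M).
  exists k; rewrite N1k leqW//; split => // n /andP[kn].
  by rewrite ltnS leq_eqVlt => /orP[/eqP ->//|nM]; apply: hk; rewrite kn.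
exists M.+1; rewrite leqnn (leq_trans N1k (leqW kM)); split => //.
  by move=> n /andP[a b]; move: (leq_ltn_trans a b); rewrite ltnn.
(* All M + 1 terms are at most [l M] < lam (M + 1), so their sum is at most lam (M + 1)^2;
   [sqr_le_4exp2] and A >= 2 give the factor 4. *)
apply: (@le_trans _ _ (4 * lam)); last by rewrite lerDr.
rewrite ler_pdivrMr ?exprn_gt0//.
have : \sum_(0 <= n < M.+1) l n <= \sum_(0 <= n < M.+1) l M.
  rewrite big_nat_cond [leRHS]big_nat_cond; apply: ler_sum => n.
  by rewrite andbT => /andP[_]; rewrite ltnS => /lmono.
move=> /le_trans; apply.
rewrite big_const_nat subn0 iter_addr_0 -[leLHS]mulr_natr.
apply: (@le_trans _ _ (lam * (M.+1%:R * M.+1%:R))).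
  by rewrite mulrA ler_wpM2r// ltW.
rewrite [4 * _]mulrC -mulrA ler_wpM2l//.
apply: (@le_trans _ _ (4 * 2 ^+ M.+1)); last first.
  by rewrite ler_wpM2l// lerXn2r// nnegrE//; lra.
rewrite -natrM -natrX -natrM ler_nat.
by rewrite -[(M.+1 * M.+1)%N]/(M.+1 ^ 2)%N sqr_le_4exp2.
Qed.

(* If neither the crude nor the fine gap condition is ever met, then
   [v n := 1 + (sum of the first n terms) / A ^ n] stays bounded: it decays up to a
   summable error from the last slow index until [r] steps before the first time [v]
   would exceed the threshold [T], and can only grow by the factor [F] in each of the
   [r] remaining steps. *)
Lemma gapless_growth_bounded (R : realType) (d : nat) (kappa delta K lam : R)
    (l : nat -> R) (N1 : nat) :
  (0 < d)%N -> 0 < kappa -> kappa < 1 -> 0 < delta -> 0 <= K -> 0 <= lam ->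
  {homo l : m n / (m <= n)%N >-> m <= n} -> (forall n, 0 <= l n) ->
  (forall n, (N1 <= n)%N -> (K + 2) * (d.+1%:R `^ (kappa - 1)) ^+ n.+1 <= 2^-1) ->
  (forall n, (N1 <= n)%N -> delta * l n <= d%:R * (\sum_(0 <= i < n) l i) + K) ->
  (forall n M, (N1 <= n <= M)%N ->
    (forall i, (n <= i < M)%N -> lam * i.+1%:R <= l i) ->
    d%:R * (\sum_(0 <= i < n) l i) + K <= delta * l M ->
    l n - 2 * l n `^ kappa <= d%:R * (\sum_(0 <= i < n) l i) + K) ->
  exists T : R, forall n, l n < T * d.+1%:R ^+ n.
Proof.
move=> d0 k0 k1 del0 K0 lam0 lmono l0 hq hcrude hfine.
set A : R := d.+1%:R; pose S n := \sum_(0 <= i < n) l i.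
have SS n : S n.+1 = S n + l n by rewrite /S big_nat_recr.
have S0 n : 0 <= S n by apply: sumr_ge0.
have Smono : {homo S : m n / (m <= n)%N >-> m <= n}.
  by apply: homo_leq => // [x y z /le_trans|n]; [exact|rewrite SS lerDl].
have A2 : 2 <= A by rewrite ler_nat.
have A1 : 1 <= A by lra.
have A0 : 0 < A by lra.
have dA : d%:R = A - 1 :> R by rewrite /A -addn1 natrD addrK.
have d1 : 1 <= d%:R :> R by rewrite ler1n.
set q := A `^ (kappa - 1).
have q0 : 0 < q by rewrite powR_gt0.
have q1 : q < 1.
  rewrite /q -opprB powRN invf_lt1 ?powR_gt0//.
  by rewrite -[ltLHS](powRr0 A) /powR gt_eqF// ltr_expR ltr_pM2r ?subr_gt0 ?ln_gt0//; lra.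
pose v n := 1 + S n / A ^+ n.
have v1 n : 1 <= v n by rewrite lerDl divr_ge0 ?exprn_ge0// ltW.
(* The failed crude condition bounds [l n] by (d S_n + K) / delta, so [v] grows by at most this
   factor in one step. *)
pose F := 1 + d%:R / delta + K / delta.
have F1 : 1 <= F.
  by rewrite /F -addrA lerDl addr_ge0// divr_ge0// ltW.
have F0 : 0 <= F by lra.
have coarse n : (N1 <= n)%N -> v n.+1 <= F * v n.
  move=> N1n; have := hcrude _ N1n; rewrite -/(S n) -ler_pdivlMl// => hl.
  have Ai : 0 < A ^+ n.+1 by rewrite exprn_gt0.
  have P1 : 1 <= A ^+ n by rewrite exprn_ege1.
  have : S n.+1 / A ^+ n.+1 <= S n.+1 / A ^+ n.
    rewrite ler_wpM2l// lef_pV2 ?posrE ?exprn_gt0//.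
    by rewrite exprS ler_peMl// exprn_ge0// ltW.
  have : S n.+1 / A ^+ n <= (S n + delta^-1 * (d%:R * S n + K)) / A ^+ n.
    by rewrite ler_wpM2r ?invr_ge0 ?exprn_ge0 ?(ltW A0)// SS lerD2l.
  have : K / delta / A ^+ n <= K / delta.
    by rewrite ler_piMr ?invf_le1 ?exprn_gt0// divr_ge0// ltW.
  have -> : (S n + delta^-1 * (d%:R * S n + K)) / A ^+ n
     = (1 + d%:R / delta) * (S n / A ^+ n) + K / delta / A ^+ n.
    by field; rewrite !gt_eqF ?exprn_gt0.
  have : 0 <= K / delta * (S n / A ^+ n).
    by rewrite mulr_ge0 ?divr_ge0 ?exprn_ge0// ltW.
  have : 0 <= d%:R / delta by rewrite divr_ge0// ltW.
  by rewrite /v /F; lra.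
have coarses n i : (N1 <= n)%N -> v (n + i)%N <= F ^+ i * v n.
  move=> N1n; elim: i => [|i IH]; first by rewrite addn0 expr0 mul1r.
  rewrite addnS; apply: le_trans (coarse _ (leq_trans N1n (leq_addr _ _))) _.
  by rewrite exprS -mulrA ler_wpM2l.
(* At the crossing found below, [l M] is at least d T A^M; when n + r <= M this makes delta l_M
   dominate d S_n + K, as [hfine] requires. *)
have [r hr] : exists r : nat, 2 / delta <= A ^+ r.
  exists (Num.bound (2 / delta)).
  have : 2 / delta < (Num.bound (2 / delta))%:R.
    by apply: archi_boundP; rewrite divr_ge0// ltW.
  move=> /ltW /le_trans; apply.
  apply: (@le_trans _ _ (2 ^+ Num.bound (2 / delta))).
    by rewrite -natrX ler_nat ltnW// ltn_expl.
  by rewrite lerXn2r ?nnegrE//; lra.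
pose c := 2 * (K + 2) * q / (1 - q).
have c0 : 0 <= c.
  have := q1; rewrite -subr_gt0 => q1p.
  by rewrite divr_ge0 ?(ltW q1p)// mulr_ge0 ?(ltW q0)// mulr_ge0// addr_ge0.
pose U := S N1 + 4 * lam.
have U0 : 0 <= U by rewrite addr_ge0// mulr_ge0.
(* The first summand will bound [v M.+1], the second absorbs K, and the third puts the first
   crossing of the threshold beyond N1. *)
pose T := F ^+ r.+1 * expR c * (1 + U) + 2 * K / delta + S N1.
have FU1 : 1 <= F ^+ r.+1 * expR c * (1 + U).
  rewrite -[leLHS]mulr1 ler_pM// ?lerDl// -[leLHS]mulr1 ler_pM// ?exprn_ege1//.
  by apply: le_trans (expR_ge1Dx _); rewrite lerDl.
have Kd0 : 0 <= 2 * K / delta by rewrite divr_ge0 ?mulr_ge0// ltW.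
have T1 : 1 <= T by move: (S0 N1); rewrite /T; lra.
(* The extra factor A turns a large [l n0] into a partial sum S_(n0+1) >= T A^(n0+1), so a first
   crossing exists. *)
exists (T * A) => n0; rewrite ltNge; apply/negP => hn0.
have exM : exists n, T * A ^+ n.+1 <= S n.+1.
  by exists n0; rewrite SS exprS mulrA (le_trans hn0)// lerDr.
have {exM} [M hM Mmin] := ex_minnP exM.
have ST n : (n <= M)%N -> S n < T * A ^+ n.
  case: n => [_|n nM]; first by rewrite expr0 mulr1 /S big_geq//; lra.
  by rewrite ltNge; apply/negP => /Mmin; rewrite leqNgt nM.
have N1M : (N1 <= M)%N.
  rewrite leqNgt; apply/negP => MN1.
  have : S M.+1 < T * A ^+ M.+1.
    apply: (@lt_le_trans _ _ T); last by rewrite ler_peMr ?exprn_ege1//; lra.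
    by apply: le_lt_trans (Smono _ _ MN1) _; rewrite /T; lra.
  by rewrite ltNge hM.
(* At the first crossing, a single term bridges the gap from T A^M to T A^(M+1). *)
have lM : d%:R * T * A ^+ M <= l M.
  have := ST _ (leqnn M); move: hM; rewrite SS exprS dA; lra.
have [k [/andP[N1k kM] hk Sk]] := last_slow_index A2 lam0 lmono l0 N1M.
have vk : v k <= 1 + U by rewrite lerD2l.
have fine n : (k <= n)%N -> (n + r <= M)%N ->
    v n.+1 * expR (c * q ^+ n.+1) <= v n * expR (c * q ^+ n).
  move=> kn nrM.
  have nM : (n <= M)%N by apply: leq_trans nrM; rewrite leq_addr.
  have N1n := leq_trans N1k kn.
  apply: decay_step => //; [lra|exact: ltW|by apply: le_trans (v1 n)|exact: hq|].
  rewrite /v SS; apply: fine_step => //.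
  have := hfine n M; rewrite N1n nM -/(S n) => /(_ isT) hf.
  suff : l n - 2 * l n `^ kappa <= d%:R * S n + K by rewrite dA; lra.
  apply: hf => [i /andP[ni iM]|]; first by rewrite hk// iM (leq_trans kn).
  have hSn : S n <= T * A ^+ n by apply/ltW/ST.
  have : delta * (d%:R * T * A ^+ M) <= delta * l M by rewrite ler_pM2l.
  have : d%:R * T * A ^+ n * (2 / delta) <= d%:R * T * A ^+ M.
    rewrite -!mulrA ler_wpM2l// ler_wpM2l//; first lra.
    apply: (@le_trans _ _ (A ^+ n * A ^+ r)).
      by rewrite ler_wpM2l// exprn_ge0// ltW.
    by rewrite -exprD ler_weXn2l.
  rewrite mulrA ler_pdivrMr//.
  have : d%:R * S n <= d%:R * (T * A ^+ n) by rewrite ler_wpM2l.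
  have : 2 * K <= T * delta.
    by rewrite -ler_pdivrMr//; move: (S0 N1); rewrite /T; lra.
  have : T * delta <= d%:R * T * A ^+ M * delta.
    rewrite ler_pM2r// mulrC mulrA ler_peMl//; first lra.
    by rewrite -[leLHS]mulr1 ler_pM// exprn_ege1.
  lra.
have fines i : (k + i <= M.+1 - r)%N ->
    v (k + i)%N * expR (c * q ^+ (k + i)) <= v k * expR (c * q ^+ k).
  elim: i => [|i IH] hi; first by rewrite addn0.
  rewrite addnS in hi *; apply: le_trans (IH (ltnW hi)).
  apply: fine; first exact: leq_addr.
  by move: hi; clear; lia.
have vM : v M.+1 <= F ^+ r.+1 * expR c * (1 + U).
  have qle n : expR (c * q ^+ n) <= expR c.
    by rewrite ler_expR ler_piMr// exprn_ile1// ltW.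
  (* A stretch of at most [r] steps is covered by the coarse bound alone. *)
  have [Mk|kM'] := leqP (M.+1 - r) k.
    have := coarses k (M.+1 - k)%N N1k; rewrite subnKC ?leqW// => /le_trans; apply.
    rewrite ler_pM//; first by rewrite exprn_ge0.
      by apply: le_trans (v1 k).
    rewrite -[leLHS]mulr1 ler_pM ?exprn_ge0//; last first.
      by apply: le_trans (expR_ge1Dx _); rewrite lerDl.
    rewrite ler_weXn2l//.
    by move: Mk; clear; lia.
  have := fines (M.+1 - r - k)%N; rewrite subnKC ?(ltnW kM')// => /(_ (leqnn _)).
  set j := (M.+1 - r)%N in kM' * => hj.
  have vj : v j <= expR c * (1 + U).
    apply: (@le_trans _ _ (v j * expR (c * q ^+ j))).
      rewrite ler_peMr//; first by apply: le_trans (v1 j).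
      by apply: le_trans (expR_ge1Dx _); rewrite lerDl mulr_ge0// exprn_ge0// ltW.
    apply: le_trans hj _; rewrite mulrC ler_pM ?expR_ge0//.
    by apply: le_trans (v1 k).
  have := coarses j (M.+1 - j)%N (leq_trans N1k (ltnW kM')).
  rewrite subnKC ?leq_subr// => /le_trans; apply.
  rewrite -mulrA ler_pM// ?exprn_ge0//; first by apply: le_trans (v1 j).
  by rewrite ler_weXn2l// /j; clear; lia.
have : T <= S M.+1 / A ^+ M.+1 by rewrite ler_pdivlMr ?exprn_gt0.
move: vM (S0 N1); rewrite /v /T; lra.
Qed.

Lemma small_tail_index (R : realType) (eps kappa : R) (d : nat) (l : nat -> R) :
  0 < eps -> 0 < kappa -> kappa < 1 -> (0 < d)%N ->
  {homo l : m n / (m <= n)%N >-> m <= n} ->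
  (forall n, (1 + eps) * ln n.+1%:R <= l n) ->
  (forall T : R, exists n, T * d.+1%:R ^+ n <= l n) ->
  forall (eta : R) (N0 : nat), 0 < eta ->
  exists N (tau : R), [/\ (N0 <= N)%N,
    forall M, \sum_(N <= n < M) expR (l n `^ kappa - l n) <= tau &
    expR (d%:R * \sum_(0 <= n < N) l n) * tau <= eta].
Proof.
move=> e0 k0 k1 d0 lmono lge lunb eta N0 eta0.
have [C [delta [C0 del0 htail]]] := crude_tail_bound e0 k0 k1.
have {htail} htail := htail _ lmono lge.
have l0 n : 0 <= l n.
  apply: le_trans (lge n); rewrite mulr_ge0 ?addr_ge0 ?(ltW e0)//.
  by rewrite ln_ge0// ler1n.
(* C comes from the crude bound and 2 from the fine one; [K] makes their sum times exp (- K) at most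
   [eta]. *)
pose K := ln (1 + (C + 2) / eta).
have Ce : 0 < (C + 2) / eta by rewrite divr_gt0// addr_gt0.
have K0 : 0 <= K by rewrite ln_ge0// lerDl ltW.
have hK : (C + 2) * expR (- K) <= eta.
  rewrite expRN lnK ?posrE ?addr_gt0// ler_pdivrMr ?addr_gt0//.
  by rewrite mulrDr mulrCA divff ?gt_eqF// !mulr1 lerDr ltW.
apply: contrapT => hbad.
set A : R := d.+1%:R.
pose q := A `^ (kappa - 1).
(* From size X on, l^(1 - kappa) >= 2, as [fine_tail_bound] requires. *)
pose X := 2 `^ ((1 - kappa)^-1) : R.
have [N1 [N01 hX hq]] : exists N1, [/\ (N0 <= N1)%N,
    (forall n, (N1 <= n)%N -> X <= l n) &
    (forall n, (N1 <= n)%N -> (K + 2) * q ^+ n.+1 <= 2^-1)].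
  have [N2 hN2] : exists N2 : nat, forall n, (N2 <= n)%N -> X <= l n.
    exists (Num.bound (expR X)) => n hn.
    apply: le_trans (lge n).
    have h1 : X <= ln n.+1%:R.
      rewrite -[leLHS]expRK ler_ln ?posrE ?expR_gt0// ?ltr0n//.
      apply: le_trans (ltW (archi_boundP (expR_ge0 _))) _.
      by rewrite ler_nat leqW.
    apply: le_trans h1 _; rewrite ler_peMl ?lerDl ?(ltW e0)//.
    by rewrite ln_ge0// ler1n.
  have q0 : 0 < q by rewrite powR_gt0.
  have q1 : q < 1.
    rewrite /q -opprB powRN invf_lt1 ?powR_gt0//.
    rewrite -[ltLHS](powRr0 A) /powR gt_eqF// ltr_expR ltr_pM2r ?subr_gt0//.
    by rewrite ln_gt0// ltr1n.
  have [N3 hN3] : exists N3 : nat, forall n, (N3 <= n)%N -> (K + 2) * q ^+ n.+1 <= 2^-1.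
    have /cvgrPdist_lt /(_ (2^-1 / (K + 2))) : q ^+ n @[n --> \oo] --> 0.
      by apply: cvg_expr; rewrite ger0_norm ?ltW.
    have K2 : 0 < K + 2 by rewrite ltr_wpDl.
    rewrite divr_gt0 ?invr_gt0// => /(_ isT) [N3 _ hN3].
    exists N3 => n hn; have := hN3 n.+1 (leqW hn).
    rewrite /= sub0r normrN ger0_norm ?exprn_ge0 ?(ltW q0)//.
    by rewrite ltr_pdivlMr// mulrC => /ltW.
  exists (maxn N0 (maxn N2 N3)); split; first exact: leq_maxl.
    by move=> n; rewrite !geq_max => /and3P[_ ? _]; apply: hN2.
  by move=> n; rewrite !geq_max => /and3P[_ _ ?]; apply: hN3.
have X0 : 0 < X by rewrite powR_gt0.
pose lam : R := (2 / kappa) `^ kappa^-1.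
have lam0 : 0 <= lam by exact: powR_ge0.
have crude n : (N1 <= n)%N -> delta * l n <= d%:R * (\sum_(0 <= i < n) l i) + K.
  move=> N1n; rewrite leNgt; apply/negP => hn; apply: hbad.
  exists n, (C * expR (- (delta * l n))); split; [exact: leq_trans N1n|exact: htail|].
  rewrite mulrCA -expRD.
  apply: le_trans hK; rewrite ler_pM ?expR_ge0 ?(ltW C0)//.
    by rewrite lerDl.
  by rewrite ler_expR; lra.
have fine n M : (N1 <= n <= M)%N ->
    (forall i, (n <= i < M)%N -> lam * i.+1%:R <= l i) ->
    d%:R * (\sum_(0 <= i < n) l i) + K <= delta * l M ->
    l n - 2 * l n `^ kappa <= d%:R * (\sum_(0 <= i < n) l i) + K.
  move=> /andP[N1n nM] hlin hM; rewrite leNgt; apply/negP => hn; apply: hbad.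
  (* The tail is split at M: the fine bound holds while growth is linear, and [l M] is large enough
     for the crude bound from M on. *)
  exists n, (2 * expR (- (l n - 2 * l n `^ kappa)) + C * expR (- (delta * l M))).
  split; first exact: leq_trans N1n.
    have ln0 : 0 < l n by apply: lt_le_trans (hX _ N1n).
    have ln2 : 2 <= l n `^ (1 - kappa).
      have -> : 2 = X `^ (1 - kappa) :> R.
        by rewrite /X -powRrM mulVf ?powRr1// subr_eq0 gt_eqF.
      by rewrite ge0_ler_powR ?nnegrE ?subr_ge0 ?(ltW k1) ?(ltW X0) ?hX.
    have hf := fine_tail_bound k0 k1 lmono ln0 ln2 hlin.
    move=> M'; apply: (@le_trans _ _ (\sum_(n <= i < maxn M M') expR (l i `^ kappa - l i))).
      have [nM'|M'n] := leqP n M'; last first.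
        by rewrite big_geq ?(ltnW M'n)// sumr_ge0// => i _; rewrite expR_ge0.
      rewrite [leRHS](big_cat_nat (n := M'))//= ?leq_maxr//.
      by rewrite lerDl sumr_ge0// => i _; rewrite expR_ge0.
    rewrite (big_cat_nat (n := M))//= ?leq_maxl//.
    exact: lerD.
  rewrite mulrDr !(mulrCA (expR _)) -!expRD.
  apply: le_trans hK; rewrite [leRHS]mulrDl [leLHS]addrC; apply: lerD.
    by rewrite ler_wpM2l ?(ltW C0)// ler_expR; lra.
  by rewrite ler_wpM2l// ler_expR; lra.
have [T hT] := gapless_growth_bounded d0 k0 k1 del0 K0 lam0 lmono l0 hq crude fine.
have [n hn] := lunb T.
by have := hT n; rewrite ltNge hn.
Qed.

(** * Reordering the terms by increasing denominators *)

Lemma injective_unbounded (s : nat -> nat) (n : nat) : injective s ->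
  exists2 i, (i <= n)%N & (n <= s i)%N.
Proof.
move=> sinj; apply: contrapT => hno.
have /uniq_leq_size : uniq (map s (iota 0 n.+1)) by rewrite map_inj_uniq ?iota_uniq.
move=> /(_ (iota 0 n)); rewrite size_map !size_iota ltnn => H.
suff /H : {subset [seq s i | i <- iota 0 n.+1] <= iota 0 n} by [].
move=> z /mapP[i]; rewrite mem_iota /= add0n => hi ->.
rewrite mem_iota /= add0n ltnNge; apply/negP => ni; apply: hno.
by exists i.
Qed.

(* The n-th index is chosen greedily, as a minimiser of [x] among the unused ones. *)
Lemma nondecreasing_enumeration (x : nat -> nat) : (forall n, (n <= x n)%N) ->
  exists s : nat -> nat, [/\ injective s, forall j, exists n, s n = j &
    {homo x \o s : m n / (m <= n)%N >-> (m <= n)%N}].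
Proof.
move=> xge.
have /choice[nxt hnxt] (r : seq nat) : exists j, j \notin r /\
    forall i, i \notin r -> (x j <= x i)%N.
  have exv : exists v, `[< exists2 j, j \notin r & x j = v >].
    exists (x (foldr maxn 0%N r).+1); apply/asboolP; exists (foldr maxn 0%N r).+1 => //.
    apply/negP => hin.
    suff : forall j, j \in r -> (j <= foldr maxn 0 r)%N by move/(_ _ hin); rewrite ltnn.
    elim: r {hin} => //= a r IH j; rewrite inE leq_max => /orP[/eqP ->|/IH ->].
      by rewrite leqnn.
    by rewrite orbT.
  have [v /asboolP[j jr <-] vmin] := ex_minnP exv.
  by exists j; split => // i ir; apply: vmin; apply/asboolP; exists i.
pose S n := iter n (fun r => rcons r (nxt r)) [::].
pose s n := nxt (S n).
have SS n : S n.+1 = rcons (S n) (s n) by [].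
have memS i n : (i < n)%N -> s i \in S n.
  elim: n => // n IH; rewrite ltnS leq_eqVlt SS mem_rcons inE.
  by move=> /orP[/eqP ->|/IH ->]; rewrite ?eqxx ?orbT.
have Smem j n : j \in S n -> exists i, s i = j.
  by elim: n => // n IH; rewrite SS mem_rcons inE => /orP[/eqP ->|/IH//]; exists n.
have sne i n : (i < n)%N -> s i != s n.
  by move=> /memS sin; apply: contraTneq sin => ->; case: (hnxt (S n)).
have sinj : injective s.
  move=> i n sin; have [/sne|/sne|//] := ltngtP i n; by rewrite sin eqxx.
exists s; split => //.
  (* An index never chosen would bound every x (s i) by x j, but [s] takes arbitrarily large values
     and x n >= n. *)
  move=> j; apply: contrapT => hno.
  have [i _ hi] := injective_unbounded (x j).+1 sinj.
  have jS : j \notin S i by apply/negP => /Smem.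
  have [_ /(_ _ jS)] := hnxt (S i); rewrite -/(s i) => hle.
  by have := leq_trans hi (leq_trans (xge _) hle); rewrite ltnn.
apply: homo_leq => [n|b a c /=|n /=]; [exact: leqnn|exact: leq_trans|].
have [_] := hnxt (S n); apply; apply/negP => hin.
have [hn _] := hnxt (S n.+1); move: hn.
by rewrite -/(s n.+1) SS mem_rcons inE hin orbT.
Qed.

(** A long partial sum in the original order contains the first N rearranged terms; what is left of
    it is a finite piece of the rearranged tail. *)
Lemma rearranged_remainder_le (R : realType) (t h : nat -> R) (s : nat -> nat)
    (l tau : R) (N : nat) :
  injective s -> (forall j, exists n, s n = j) ->
  (forall n, `|t (s n)| <= h n) ->
  (forall M, \sum_(N <= n < M) h n <= tau) ->
  \sum_(0 <= j < J) t j @[J --> \oo] --> l ->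
  `|l - \sum_(0 <= n < N) t (s n)| <= tau.
Proof.
move=> sinj ssurj th htau tl; set SN := \sum_(0 <= n < N) _.
have /choice[s' s'K] := ssurj.
pose J0 := (\max_(n < N) (s n).+1)%N.
have hJ0 n : (n < N)%N -> (s n < J0)%N.
  by move=> nN; apply: (@leq_bigmax_cond _ xpredT (fun n : 'I_N => (s n).+1) (Ordinal nN)).
have partial J : (J0 <= J)%N -> `|\sum_(0 <= j < J) t j - SN| <= tau.
  move=> J0J; pose M := maxn N (\max_(j < J) (s' j).+1)%N.
  have hM j : (j < J)%N -> (s' j < M)%N.
    move=> jJ; rewrite leq_max; apply/orP; right.
    exact: (@leq_bigmax_cond _ xpredT (fun n : 'I_J => (s' n).+1) (Ordinal jJ)).
  have perm : perm_eq (index_iota 0 J) [seq s n | n <- index_iota 0 M & (s n < J)%N].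
    apply: uniq_perm; first exact: iota_uniq.
      by rewrite map_inj_uniq// filter_uniq// iota_uniq.
    move=> j; rewrite mem_index_iota /=; apply/idP/mapP => [jJ|[n]].
      exists (s' j); last by rewrite s'K.
      by rewrite mem_filter s'K jJ mem_index_iota hM.
    by rewrite mem_filter => /andP[? _] ->.
  have NM : (N <= M)%N by rewrite leq_maxl.
  rewrite (perm_big _ perm) /= big_map big_filter (big_cat_nat (leq0n N) NM)/=.
  have -> : \sum_(0 <= i < N | (s i < J)%N) t (s i) = SN.
    rewrite /SN big_nat_cond [RHS]big_nat; apply: eq_bigl => i.
    by have [iN|] := ltnP i N; rewrite ?andbF//= (leq_trans (hJ0 _ iN) J0J).
  rewrite addrAC subrr add0r.
  apply: le_trans (ler_norm_sum _ _ _) _.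
  apply: le_trans (htau M); rewrite big_mkcond /=; apply: ler_sum => i _.
  by case: ifP => // _; apply: le_trans (th i).
apply/ler_addgt0Pl => e e0.
have /cvgrPdist_le /(_ _ e0) [J1 _ hJ1] := tl.
have := hJ1 (maxn J0 J1) (leq_maxr _ _); have := partial (maxn J0 J1) (leq_maxl _ _).
set P := \sum_(0 <= j < _) t j => h1 h2.
by apply: le_trans (ler_distD P _ _) _; rewrite lerD.
Qed.

(** * Values of integer polynomials and poles at a prime *)

Lemma horner_int_scaled (R : realType) (f : {poly int}) (d : nat) (S : R) (s q : int) :
  size f = d.+1 -> S * q%:~R = s%:~R ->
  (map_poly intr f).[S] * q%:~R ^+ d
    = (\sum_(i < d.+1) f`_i * s ^+ i * q ^+ (d - i))%:~R.
Proof.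
move=> sf hS.
have sf' : (size (map_poly intr f : {poly R}) <= d.+1)%N.
  by rewrite -sf size_poly.
rewrite (horner_coef_wide _ sf') mulr_suml rmorph_sum /=.
apply: eq_bigr => i _; rewrite coef_map_id0 ?rmorph0//.
have id : (i <= d)%N by rewrite -ltnS.
by rewrite !rmorphM /= !rmorphXn /= -hS exprMn -!mulrA -exprD subnKC.
Qed.

(** Factor f = g (X - x): [g] is bounded near [x], while f(S) q^d is a non-zero integer, hence at
    least 1 in absolute value. *)
Lemma liouville_bound (R : realType) (f : {poly int}) (d : nat) (x : R) :
  size f = d.+1 -> root (map_poly intr f) x ->
  exists2 K : R, 0 < K & forall (S : R) (s q : int), q != 0 ->
    S * q%:~R = s%:~R -> ~~ root (map_poly intr f) S -> `|x - S| <= 1 ->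
    1 <= K * `|x - S| * `|q%:~R| ^+ d.
Proof.
move=> sf /factor_theorem[g fg].
have [K K0 hK] : exists2 K : R, 0 < K & forall S, `|x - S| <= 1 -> `|g.[S]| <= K.
  exists (1 + \sum_(i < size g) `|g`_i| * (1 + `|x|) ^+ i).
    by rewrite ltr_pwDl// sumr_ge0// => i _; rewrite mulr_ge0// exprn_ge0// addr_ge0.
  move=> S xS; rewrite horner_coef.
  apply: le_trans (ler_norm_sum _ _ _) _; rewrite -[leLHS]add0r lerD// ler_sum// => i _.
  rewrite normrM normrX ler_wpM2l// lerXn2r ?nnegrE ?addr_ge0//.
  have := ler_distD x S 0; rewrite !subr0 distrC => /le_trans; apply.
  by rewrite lerD2r.
exists K => // S s q q0 hS fS xS.
have key := horner_int_scaled sf hS.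
set z := \sum_(i < d.+1) _ in key.
have z0 : z != 0.
  apply: contraNneq fS => z0; move: key; rewrite z0 rmorph0 => /eqP.
  by rewrite mulf_eq0 expf_eq0 intr_eq0 (negPf q0) andbF orbF rootE.
have : 1 <= `|z%:~R| :> R by rewrite -intr_norm ler1z -gtz0_ge1 normr_gt0.
rewrite -key fg hornerM !normrM normrX => /le_trans; apply.
rewrite ler_wpM2r ?exprn_ge0// hornerXsubC distrC ler_wpM2r//.
exact: hK.
Qed.

(** After clearing denominators, every term below the leading one carries a factor [p], so [p] would
    divide [lead_coef f] times a power of [s]. *)
Lemma pole_not_root (R : realType) (f : {poly int}) (p : nat) (S : R) (s q : int) :
  prime p -> ~~ (p%:Z %| lead_coef f)%Z -> ~~ (p%:Z %| s)%Z ->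
  S * (p%:Z * q)%:~R = s%:~R -> ~~ root (map_poly intr f) S.
Proof.
move=> pp plf ps hS; apply/negP => /rootP fS.
have f0 : f != 0 by apply: contraNneq plf => ->; rewrite lead_coef0 dvdz0.
have sf : size f = (size f).-1.+1 by rewrite prednK// lt0n size_poly_eq0.
have := horner_int_scaled sf hS; rewrite fS mul0r => /esym/eqP.
rewrite intr_eq0 big_ord_recr /= subnn expr0 mulr1 addr_eq0 => /eqP hsum.
suff : (p%:Z %| lead_coef f * s ^+ (size f).-1)%Z.
  rewrite dvdzE abszM abszX /= Euclid_dvdM// => /orP[|]; first exact/negP.
  by rewrite Euclid_dvdX// => /andP[+ _]; apply/negP.
rewrite -[X in (_ %| X)%Z]opprK lead_coefE -hsum rpredN; apply: rpred_sum => i _.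
by rewrite dvdz_mull// exprMn dvdz_mulr// -(subnSK (ltn_ord i)) exprS dvdz_mulr.
Qed.

(** Multiplied by p^e, the term at [m] is a unit at [p] and every other term is divisible by [p], so
    the sum has a pole at [p]. Integrality at [p] is expressed by multipliers [v] prime to [p]. *)
Lemma sum_dominant_pole (R : realType) (p e m : nat) (r : seq nat) (t : nat -> R) :
  prime p -> (0 < e)%N -> uniq r -> m \in r ->
  (forall j, j != m -> exists u v : int,
     ~~ (p%:Z %| v)%Z /\ p%:R ^+ e * t j * v%:~R = (p%:Z * u)%:~R) ->
  (exists u v : int, [/\ ~~ (p%:Z %| u)%Z, ~~ (p%:Z %| v)%Z &
     p%:R ^+ e * t m * v%:~R = u%:~R]) ->
  exists s q : int, ~~ (p%:Z %| s)%Z /\ (\sum_(j <- r) t j) * (p%:Z * q)%:~R = s%:~R.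
Proof.
move=> pp e0 ur mr hj [u [v [pu pv hm]]].
have ndvdM x y : ~~ (p%:Z %| x)%Z -> ~~ (p%:Z %| y)%Z -> ~~ (p%:Z %| x * y)%Z.
  by rewrite !dvdzE abszM /= Euclid_dvdM// negb_or => -> ->.
have [u' [v' [pv' h']]] : exists u v : int, ~~ (p%:Z %| v)%Z /\
    p%:R ^+ e * (\sum_(j <- r | j != m) t j) * v%:~R = (p%:Z * u)%:~R.
  elim/big_ind : _ => [|x y [u1 [v1 [pv1 h1]]] [u2 [v2 [pv2 h2]]]|j]; last exact: hj.
    exists 0, 1; rewrite mulr0 !mul0r mulr0; split => //.
    by rewrite dvdzE /= dvdn1; apply: contraTneq pp => ->.
  exists (u1 * v2 + u2 * v1), (v1 * v2); split; first exact: ndvdM.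
  have -> : (p%:Z * (u1 * v2 + u2 * v1))%:~R
      = (p%:Z * u1)%:~R * v2%:~R + (p%:Z * u2)%:~R * v1%:~R :> R.
    by rewrite -!rmorphM -rmorphD /=; congr (_%:~R); ring.
  rewrite -h1 -h2 rmorphM /=; ring.
exists (u * v' + p%:Z * u' * v), (p%:Z ^+ e.-1 * (v * v')); split.
  apply: contra (ndvdM _ _ pu pv') => h.
  have pu' : (p%:Z %| p%:Z * u' * v)%Z by rewrite -mulrA dvdz_mulr.
  by rewrite -(addrK (p%:Z * u' * v) (u * v')) rpredB.
rewrite (bigD1_seq m)//= mulrA -exprS prednK// rmorphM /= rmorphXn /=.
rewrite -pmulrn rmorphD /= [(u * v')%:~R]rmorphM /= [X in _ = _ + X]rmorphM /= -hm -h' rmorphM /=.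
ring.
Qed.

Lemma sum_common_denominator (R : realType) (t : nat -> R) (y : nat -> nat) (N : nat) :
  (forall n, exists z : int, t n * (y n)%:R = z%:~R) ->
  exists s : int, (\sum_(0 <= n < N) t n) * (\prod_(0 <= n < N) y n)%N%:R = s%:~R.
Proof.
move=> ht; elim: N => [|N [s hs]]; first by exists 0; rewrite !big_geq// mul0r.
have [z hz] := ht N.
exists (s * (y N)%:Z + z * (\prod_(0 <= n < N) y n)%N%:Z).
rewrite !big_nat_recr//= natrM rmorphD !rmorphM /= -hs -hz -!pmulrn; ring.
Qed.

Lemma infinite_set_ndvd (P : set nat) (z : int) :
  infinite_set P -> z != 0 -> exists2 p, P p & ~~ (p%:Z %| z)%Z.
Proof.
move=> Pinf z0; apply: contrapT => hno; apply: Pinf.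
apply: (@sub_finite_set _ _ `I_(`|z|.+1)); last exact: finite_II.
move=> p Pp /=; rewrite ltnS dvdn_leq ?absz_gt0//.
apply: contrapT => /negP pz; apply: hno; exists p => //.
Qed.

(** It feeds both cases of [sum_dominant_pole]: a positive e - g supplies the factor [p], and e = g
    leaves [be] alone. *)
Lemma dominant_pole_term (R : realType) (p e g : nat) (al : nat) (be ga : int) :
  prime p -> (0 < al)%N -> ~~ (p%:Z %| ga)%Z -> logn p al = g -> (g <= e)%N ->
  exists2 v : int, ~~ (p%:Z %| v)%Z &
  p%:R ^+ e * (be%:~R / (al%:R * ga%:~R)) * v%:~R = (p%:Z ^+ (e - g) * be)%:~R :> R.
Proof.
move=> pp al0 pga lg ge.
have [al' cop alE] := pfactor_coprime pp al0.
have pal' : ~~ (p %| al')%N by rewrite -prime_coprime.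
have al'0 : al'%:R != 0 :> R.
  by rewrite pnatr_eq0; apply: contraNneq pal' => ->.
have ga0 : ga%:~R != 0 :> R.
  by rewrite intr_eq0; apply: contraNneq pga => ->.
have p0 : p%:R != 0 :> R by rewrite pnatr_eq0 -lt0n prime_gt0.
exists (al'%:Z * ga).
  by rewrite dvdzE abszM /= Euclid_dvdM// negb_or pal'; move: pga; rewrite dvdzE.
rewrite !rmorphM /= rmorphXn /= -!pmulrn alE lg natrM natrX.
rewrite -[in LHS](subnKC ge) exprD; field.
by rewrite ga0 expf_neq0.
Qed.

(** * The sum of the series is not a root of a given polynomial *)

Lemma reciprocal_sum_not_root (R : realType) (P : set nat) (eps kappa : R)
    (al : nat -> nat) (be ga : nat -> int) (d : nat) (f : {poly int}) (x : R) :
  (forall p, P p -> prime p) -> infinite_set P ->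
  0 < eps -> 0 < kappa -> kappa < 1 ->
  {homo al : m n / (m <= n)%N} ->
  (forall n, n.+1%:R `^ (1 + eps) <= (al n)%:R :> R) ->
  (forall n, `|(be n)%:~R| <= expR (ln (al n)%:R `^ kappa) :> R) ->
  (forall p n, P p -> ~~ (p%:Z %| ga n)%Z) ->
  (forall p n, P p -> ~~ (p %| gcdn (al n) `|be n|)%N) ->
  (forall p, P p -> exists m, forall n, n != m -> (logn p (al n) < logn p (al m))%N) ->
  (0 < d)%N -> size f = d.+1 ->
  (forall T : R, exists n, T * d.+1%:R ^+ n <= ln (al n)%:R) ->
  \sum_(0 <= j < J) ((be j)%:~R / ((al j)%:R * (ga j)%:~R)) @[J --> \oo] --> x ->
  ~ root (map_poly intr f) x.
Proof.
move=> Ppr Pinf e0 k0 k1 almono algrow hbe hga hgcd hmax d0 sf alunb tx fx.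
set t := fun j => (be j)%:~R / ((al j)%:R * (ga j)%:~R) : R.
have [p0 Pp0] : exists p, P p.
  by have [p Pp _] := infinite_set_ndvd Pinf (oner_neq0 int); exists p.
have ga0 n : ga n != 0 by apply: contraNneq (hga _ n Pp0) => ->; rewrite dvdz0.
have al_ge n : (n.+1 <= al n)%N.
  rewrite -(ler_nat R); apply: le_trans (algrow n).
  by rewrite le1r_powR ?ler1n// lerDl ltW.
have al0 n : (0 < al n)%N by apply: leq_trans (al_ge n).
pose X j := (al j * `|ga j|)%N.
have alX j : (al j <= X j)%N by rewrite leq_pmulr// absz_gt0.
have Xge n : (n <= X n)%N by apply: leq_trans (alX n); apply: leq_trans (al_ge n).
have X0 n : (0 < X n)%N by apply: leq_trans (alX n).
have [s [sinj ssurj smono]] := nondecreasing_enumeration Xge.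
pose y n := X (s n); pose L n : R := ln (y n)%:R.
have y0 n : 0 < (y n)%:R :> R by rewrite ltr0n X0.
have Lmono : {homo L : m n / (m <= n)%N >-> m <= n}.
  by move=> m n mn; rewrite ler_ln ?posrE// ler_nat; apply: smono.
(* One of s 0, ..., s n is at least n, so [y n], the largest of their denominators, is at least
   [al n]. *)
have aly n : (al n <= y n)%N.
  have [i ni nsi] := injective_unbounded n sinj.
  by apply: leq_trans (smono _ _ ni); apply: leq_trans (alX _); apply: almono.
have alL n : ln (al n)%:R <= L n.
  by rewrite ler_ln ?posrE ?y0 ?ltr0n ?al0 ?ler_nat ?aly.
have Lge n : (1 + eps) * ln n.+1%:R <= L n.
  apply: le_trans (alL n); rewrite -ln_powR ler_ln ?posrE ?powR_gt0//.
  by rewrite ltr0n.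
have Lunb (T : R) : exists n, T * d.+1%:R ^+ n <= L n.
  by have [n hn] := alunb T; exists n; apply: le_trans (alL n).
have tX j : `|t j| = `|(be j)%:~R| / (X j)%:R.
  rewrite /t normrM normfV normrM natrM -[(`|ga j|)%:R]/(`|ga j|%N%:Z%:~R).
  by rewrite abszE intr_norm [`|(al j)%:R|]ger0_norm.
have th n : `|t (s n)| <= expR (L n `^ kappa - L n).
  rewrite tX expRB /L lnK ?posrE// ler_wpM2r ?invr_ge0//.
  apply: le_trans (hbe _) _; rewrite ler_expR ge0_ler_powR ?(ltW k0)//.
  - by rewrite nnegrE ln_ge0// ler1n.
  - by rewrite nnegrE ln_ge0// ler1n; exact: X0.
  - by rewrite ler_ln ?posrE ?y0 ?ltr0n ?al0 ?ler_nat ?alX.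
have f0 : f != 0 by rewrite -size_poly_eq0 sf.
(* [p] is prime to the leading coefficient, [m] carries the worst pole at [p], and [nm] is its place
   after sorting; N > nm puts it in [S]. *)
have [p Pp plf] : exists2 p, P p & ~~ (p%:Z %| lead_coef f)%Z.
  by apply: infinite_set_ndvd; rewrite ?lead_coef_eq0.
have pp := Ppr _ Pp.
have [m hm] := hmax _ Pp.
have [nm snm] := ssurj m.
have [K K0 hK] := liouville_bound sf fx.
(* This bound serves twice: it gives |x - S| <= 1, and it contradicts [liouville_bound] since K / (2
   (K + 1)) < 1. *)
have eta0 : 0 < (2 * (K + 1))^-1 by rewrite invr_gt0 mulr_gt0// addr_gt0.
have [N [tau [nmN htau hsmall]]] :=
  small_tail_index e0 k0 k1 d0 Lmono Lge Lunb nm.+1 eta0.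
pose S := \sum_(0 <= n < N) t (s n).
pose D := (\prod_(0 <= n < N) y n)%N.
have DE : expR (d%:R * \sum_(0 <= n < N) L n) = D%:R ^+ d.
  rewrite expRM_natl expR_sum /D natr_prod; congr (_ ^+ d).
  by apply: eq_bigr => n _; rewrite lnK ?posrE.
have D0 : (0 < D)%N by apply: prodn_gt0 => n; exact: X0.
have rem : `|x - S| <= tau by exact: (rearranged_remainder_le sinj ssurj th htau tx).
have D1 : 1 <= D%:R ^+ d :> R by rewrite exprn_ege1// ler1n.
have remD : `|x - S| * D%:R ^+ d <= (2 * (K + 1))^-1.
  by apply: le_trans hsmall; rewrite DE [leRHS]mulrC ler_wpM2r// (le_trans _ D1).
have rem1 : `|x - S| <= 1.
  apply: le_trans (_ : `|x - S| * D%:R ^+ d <= _); first by rewrite ler_peMr.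
  apply: le_trans remD _; rewrite invf_le1 ?mulr_gt0 ?addr_gt0//; lra.
have [z hz] : exists z : int, S * D%:R = z%:~R.
  apply: sum_common_denominator => n; rewrite /t /y /X; move: (s n) => j.
  (* The sign of [ga j] remains because [X] uses its absolute value. *)
  exists (be j * Num.sg (ga j)).
  rewrite natrM [(be j * _)%:~R]rmorphM /= -[(`|ga j|)%:R]/(`|ga j|%N%:Z%:~R).
  have gj0 : (ga j)%:~R != 0 :> R by rewrite intr_eq0.
  rewrite abszE -[X in _ * (_ * X%:~R)](mulr1) normrEsg rmorphM /= rmorph1 mulr1.
  by field; rewrite gj0 pnatr_eq0 -lt0n al0.
have notroot : ~~ root (map_poly intr f) S.
  pose r := [seq s n | n <- index_iota 0 N].
  have SE : S = \sum_(j <- r) t j by rewrite /r big_map.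
  (* The valuation at [m] exceeds the one at another index, for instance m + 1, so it is
     positive. *)
  have e_gt0 : (0 < logn p (al m))%N.
    by apply: leq_ltn_trans (hm m.+1 _); rewrite // gtn_eqF.
  have [||j jm||zs [q [pzs hS]]] := @sum_dominant_pole R p (logn p (al m)) m r t pp e_gt0.
  - by rewrite map_inj_uniq// iota_uniq.
  - by apply/mapP; exists nm; rewrite // mem_index_iota.
  - have hj := hm _ jm.
    have [v pv hv] := dominant_pole_term R (be j) pp (al0 j) (hga _ j Pp) erefl (ltnW hj).
    exists (p%:Z ^+ (logn p (al m) - logn p (al j)).-1 * be j), v; split => //.
    by rewrite hv mulrA -exprS prednK// subn_gt0.
  - have [v pv hv] := dominant_pole_term R (be m) pp (al0 m) (hga _ m Pp) erefl (leqnn _).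
    exists (be m), v; split => //; last by rewrite hv subnn expr0 mul1r.
    rewrite dvdzE /=; apply: contra (hgcd _ m Pp) => pb; rewrite dvdn_gcd pb andbT.
    by move: e_gt0; rewrite logn_gt0 mem_primes => /and3P[].
  - by apply: (pole_not_root pp plf pzs (q := q)); rewrite SE.
have D0' : (D%:Z != 0 :> int) by rewrite -lt0n.
have := hK S z D%:Z D0' hz notroot rem1.
rewrite -pmulrn [`|D%:R|]ger0_norm// -mulrA => h1.
have := le_trans h1 (ler_wpM2l (ltW K0) remD).
rewrite ler_pdivlMr ?mulr_gt0 ?addr_gt0// mul1r; lra.
Qed.

(** * Logarithmic form of the hypotheses and the two conclusions *)

Lemma limn_esup_pinfty_unbounded (R : realType) (u : nat -> R) (B : R) :
  limn_esup (fun n => (u n)%:E) = +oo%E -> exists n, B < u n.+1.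
Proof.
move=> hu; apply: contrapT => hno.
suff : (limn_esup (fun n => (u n)%:E) <= B%:E)%E by rewrite hu.
apply: ge_ereal_inf; exists (ereal_sup [set (u n)%:E | n in [set n | (1 <= n)%N]]).
  by exists [set n | (1 <= n)%N] => //; exists 1%N.
apply: ge_ereal_sup => _ [[//|n] _ <-]; rewrite lee_fin leNgt; apply/negP => hn.
by apply: hno; exists n.
Qed.

(** In base e, the exponent on the left is ln 2 (ln x / ln 2)^kappa = (ln 2)^(1 - kappa) (ln
    x)^kappa, and ln 2 <= 1. *)
Lemma powR2_log2_le (R : realType) (kappa x : R) : kappa < 1 -> 1 <= x ->
  2 `^ (log2 x `^ kappa) <= expR (ln x `^ kappa).
Proof.
move=> k1 x1; have ln20 : 0 < ln 2 :> R by rewrite ln_gt0// ltr1n.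
have ln21 : ln 2 <= 1 :> R by have := @le_ln1Dx R 1; apply; lra.
have lx : 0 <= ln x by rewrite ln_ge0.
rewrite /powR gt_eqF// -/(powR _ _) ler_expR /log2 powRM ?invr_ge0 ?(ltW ln20)//.
rewrite -mulrA ler_piMr ?powR_ge0// -powR_inv1 ?(ltW ln20)// -powRrM.
rewrite -{2}[ln 2]powRr1 ?(ltW ln20)// -powRD; last first.
  by apply/implyP => _; rewrite gt_eqF.
rewrite -[leRHS](powRr0 (ln 2)); apply: ger_powR; first by rewrite ln20.
lra.
Qed.

(** A large value of the root at n + 1 gives ln u_(n+1) > |T| A^(n+1), which is at least T A^n; the
    spare factor A covers the shift to indices from 0. *)
Lemma unbounded_ln_of_limsup (R : realType) (A : nat) (u : nat -> R) (T : R) :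
  (0 < A)%N -> (forall n, 0 < u n.+1) ->
  limn_esup (fun n => (u n `^ (1 / A%:R ^+ n))%:E) = +oo%E ->
  exists n, T * A%:R ^+ n <= ln (u n.+1).
Proof.
move=> A0 u0 /(limn_esup_pinfty_unbounded (expR `|T|))[n].
rewrite /powR gt_eqF// ltr_expR mul1r mulrC ltr_pdivlMr ?exprn_gt0 ?ltr0n//.
move=> /ltW hn; exists n; apply: le_trans hn.
apply: (@le_trans _ _ (`|T| * A%:R ^+ n)).
  by rewrite ler_wpM2r ?exprn_ge0// ler_norm.
by rewrite ler_wpM2l// exprS ler_peMl ?exprn_ge0// ler1n.
Qed.

Lemma rat_root_size2 (R : realType) (q : rat) : exists2 f : {poly int},
  size f = 2 & root (map_poly intr f) (ratr q : R).
Proof.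
exists (denq q *: 'X - (numq q)%:P).
  rewrite size_polyDl; first by rewrite size_scale ?denq_eq0// size_polyX.
  rewrite size_polyN size_scale ?denq_eq0// size_polyX.
  exact: leq_ltn_trans (size_polyC_leq1 _) _.
rewrite rootE rmorphB /= map_polyZ map_polyX map_polyC /= hornerD hornerN hornerZ hornerX hornerC.
by apply/eqP; rewrite /ratr; field; rewrite intr_eq0 denq_eq0.
Qed.

Lemma dominated_series_cvg (R : realType) (t h : nat -> R) (C : R) :
  (forall n, `|t n| <= h n) -> (forall N, \sum_(0 <= n < N) h n <= C) ->
  cvgn (series t).
Proof.
move=> th hC; apply: normed_cvg; apply: nondecreasing_is_cvgn.
  by apply: nondecreasing_series => n _ _; exact: normr_ge0.
exists C => _ [N _ <-]; apply: le_trans (hC N); apply: ler_sum => n _.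
exact: th.
Qed.

Theorem theorem8 (R : realType) (P : set nat) (eps kappa : R) (a b : nat -> int)
  (hPprime : forall p, P p -> prime p)
  (hPinf : infinite_set P)
  (heps : 0 < eps) (hk0 : 0 < kappa) (hk1 : kappa < 1)
  (ha0 : forall n, (1 <= n)%N -> a n != 0)
  (hb0 : forall n, (1 <= n)%N -> b n != 0)
  (hgcd : forall p n, P p -> (1 <= n)%N -> ~~ (p %| gcdn `|a n| `|b n|)%N)
  (hbdd : forall p, P p -> exists B : nat, forall n, (1 <= n)%N -> (logn p `|a n| <= B)%N)
  (hmax : forall p, P p -> exists m : nat, [/\ (1 <= m)%N,
            (forall n, (1 <= n)%N -> (logn p `|a n| <= logn p `|a m|)%N) &
            (forall n, (1 <= n)%N -> logn p `|a n| = logn p `|a m| -> n = m)])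
  (hmono : forall n, (1 <= n)%N -> a n <= a n.+1)
  (hgrow : forall n, (1 <= n)%N -> (n%:R : R) `^ (1 + eps) <= (a n)%:~R)
  (hb : forall n, (1 <= n)%N ->
          `|(b n)%:~R : R| <= 2 `^ ((log2 (`|(a n)%:~R : R|)) `^ kappa)) :
  (limn_esup (fun n => ((`|(a n)%:~R : R|) `^ (1 / (2 ^+ n)))%:E) = +oo%E ->
     P_irrational P (fun n => (a n)%:~R / (b n)%:~R : R))
  /\
  ((forall A : nat, (0 < A)%N ->
      limn_esup (fun n => (((a n)%:~R : R) `^ (1 / (A%:R ^+ n)))%:E) = +oo%E) ->
     P_transcendental P (fun n => (a n)%:~R / (b n)%:~R : R)).
Proof.
(* Indices are shifted by one, so that the auxiliary sequences start at 0. *)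
pose al n := `|a n.+1|%N.
have a0 n : 0 < a n.+1.
  rewrite -(ltr0z R); apply: lt_le_trans (hgrow n.+1 isT).
  by rewrite powR_gt0.
have alE n : (al n)%:R = (a n.+1)%:~R :> R.
  by rewrite -[(al n)%:R]/((`|a n.+1|%N)%:Z%:~R) gtz0_abs.
have almono : {homo al : m n / (m <= n)%N}.
  apply: homo_leq => [n|y x z|n]; [exact: leqnn|exact: leq_trans|].
  by rewrite -lez_nat !gtz0_abs// hmono.
have algrow n : n.+1%:R `^ (1 + eps) <= (al n)%:R :> R by rewrite alE hgrow.
have al1 n : 1 <= (al n)%:R :> R.
  by rewrite alE -[1]/(1%:~R) ler_int -gtz0_ge1.
have hbe n : `|(b n.+1)%:~R| <= expR (ln (al n)%:R `^ kappa) :> R.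
  apply: le_trans (hb n.+1 isT) _.
  by rewrite -alE ger0_norm// powR2_log2_le.
have hmax' p : P p -> exists m, forall n, n != m -> (logn p (al n) < logn p (al m))%N.
  move=> Pp; have [m [m1 mle mu]] := hmax _ Pp.
  case: m m1 mle mu => [//|m] _ mle mu; exists m => n nm.
  rewrite ltn_neqAle mle// andbT; apply: contraNneq nm => /mu - /(_ isT) [->].
  exact: eqxx.
(* Both conclusions use this: degree d requires the growth hypothesis in base d + 1, so
   irrationality (d = 1) uses base 2 and transcendence uses every base from 2 on. *)
have core c : (forall n p, (1 <= n)%N -> P p -> ~~ (p %| `|c n|)%N) ->
    exists x : R, series_from1_to
      (fun n => 1 / ((a n)%:~R / (b n)%:~R * (c n)%:~R)) x /\
    forall d (f : {poly int}), (0 < d)%N -> size f = d.+1 ->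
      (forall T : R, exists n, T * d.+1%:R ^+ n <= ln (a n.+1)%:~R) ->
      ~ root (map_poly intr f) x.
  move=> hc.
  have [p Pp _] := infinite_set_ndvd hPinf (oner_neq0 int).
  have c0 n : c n.+1 != 0.
    by apply: contraNneq (hc n.+1 p isT Pp) => ->; rewrite dvdn0.
  pose t n := (b n.+1)%:~R / ((al n)%:R * (c n.+1)%:~R) : R.
  have [C [delta [C0 del0 htail]]] := crude_tail_bound heps hk0 hk1.
  have lnmono : {homo (fun n => ln (al n)%:R : R) : m n / (m <= n)%N >-> m <= n}.
    move=> m n mn; rewrite ler_ln ?posrE ?(lt_le_trans ltr01 (al1 _))//.
    by rewrite ler_nat almono.
  have lnge n : (1 + eps) * ln n.+1%:R <= ln (al n)%:R :> R.
    by rewrite -ln_powR ler_ln ?posrE ?powR_gt0// (lt_le_trans ltr01 (al1 _)).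
  have tle n : `|t n| <= expR (ln (al n)%:R `^ kappa - ln (al n)%:R).
    have al_gt0 : 0 < (al n)%:R :> R by apply: lt_le_trans (al1 n).
    rewrite expRB lnK ?posrE// /t normrM normfV normrM [`|(al n)%:R|]gtr0_norm//.
    rewrite invfM mulrA ler_pdivrMr ?normr_gt0 ?intr_eq0//.
    apply: (@le_trans _ _ (expR (ln (al n)%:R `^ kappa) / (al n)%:R)).
      by rewrite ler_wpM2r ?invr_ge0// ltW.
    rewrite ler_peMr ?divr_ge0 ?expR_ge0 ?(ltW al_gt0)//.
    by rewrite -intr_norm ler1z -gtz0_ge1 normr_gt0.
  have ct := dominated_series_cvg tle (htail _ lnmono lnge 0%N).
  exists (limn (series t)); split.
    rewrite /series_from1_to -cvg_shiftS.
    suff -> : [sequence \sum_(1 <= k < n.+1) 1 / ((a k)%:~R / (b k)%:~R * (c k)%:~R)]_n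
      = series t by [].
    apply/funext => n /=; rewrite /series /= big_add1 /=; apply: eq_bigr => k _.
    rewrite /t alE; field.
    by rewrite !intr_eq0 ha0// hb0// c0.
  move=> d f d0 sf hunb.
  apply: (reciprocal_sum_not_root hPprime hPinf heps hk0 hk1 almono algrow
    (be := fun n => b n.+1) (ga := fun n => c n.+1) hbe _ _ hmax' d0 sf _ ct).
  - by move=> q n Pq; rewrite dvdzE hc.
  - by move=> q n Pq; rewrite hgcd.
  - by move=> T; have [n hn] := hunb T; exists n; rewrite alE.
have a0R n : 0 < (a n.+1)%:~R :> R by rewrite ltr0z.
split => [hsup c hc|hsup c hc]; have [x [hx nroot]] := core c hc; exists x; split => //.
  move=> [q qE]; have [f sf rf] := rat_root_size2 R q.
  apply: (nroot 1%N f) => //; last by rewrite qE.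
  move=> T; have [|n hn] := unbounded_ln_of_limsup T (A := 2) isT _ hsup.
    by move=> n; rewrite normr_gt0 gt_eqF.
  by exists n; move: hn; rewrite gtr0_norm.
move=> [f [f0 rf]].
(* A non-zero constant has no root, so the degree is positive. *)
have [f1|f1] := leqP (size f) 1.
  move: rf; rewrite (size1_polyC f1) map_polyC /= rootC intr_eq0 => /eqP f00.
  by move: f0; rewrite (size1_polyC f1) f00 eqxx.
apply: (nroot (size f).-1 f) => //; first by rewrite -subn1 subn_gt0.
  by rewrite prednK// ltnW.
by move=> T; apply: (unbounded_ln_of_limsup T (u := fun n => (a n)%:~R)) => //; apply: hsup.
Qed.
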